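(* Let $(\mathcal{N},\pi)$ be a square colored pattern matrix, with $\mathcal{N}\in\{0,\ast,?\}^{t\times t}$, and let $G(\mathcal{N},\pi)=(X,Y,E_{XY},\pi_{XY})$ be its associated colored bipartite graph. Then $(\mathcal{N},\pi)$ is nonsingular (i.e. every complex matrix in $\mathcal{P}(\mathcal{N},\pi)$ is nonsingular) if and only if the following three conditions hold in $G(\mathcal{N},\pi)$: 1. there exists at least one perfect matching; 2. exactly one equivalence class of perfect matchings has a nonzero signature; 3. the spectrum of this equivalence class contains only colors corresponding to edges in $E^{\ast}_{XY}$ (solid edges).
   Context: A pattern matrix is a matrix with entries in the set of symbols $\{0,\ast,?\}$. Let $\mathcal{N}\in\{0,\ast,?\}^{t\times t}$. Let $\mathcal{I}_{\mathcal N}(\ast)$ and $\mathcal{I}_{\mathcal N}(?)$ be the sets of locations $(i,j)$ with $\mathcal{N}_{ij}=\ast$, respectively $\mathcal{N}_{ij}=?$. A coloring of $\mathcal{N}$ is $\pi=\{\mathcal{I}^\ast_1,\ldots,\mathcal{I}^\ast_k,\mathcal{I}^?_1,\ldots,\mathcal{I}^?_l\}$, where $\{\mathcal{I}^\ast_1,\ldots,\mathcal{I}^\ast_k\}$ is a partition of $\mathcal{I}_{\mathcal N}(\ast)$ and $\{\mathcal{I}^?_1,\ldots,\mathcal{I}^?_l\}$ is a partition of $\mathcal{I}_{\mathcal N}(?)$. The pair $(\mathcal{N},\pi)$ is called a (square) colored pattern matrix. Entries with locations in $\mathcal{I}^\ast_r$ are said to have color $c_r$ and those in $\mathcal{I}^?_s$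 color $g_s$; the colors $c_1,\ldots,c_k,g_1,\ldots,g_l$ are distinct symbols. For square pattern matrices, complex matrices are allowed: the pattern class $\mathcal{P}(\mathcal{N},\pi)$ is the set of all $N\in\mathbb{C}^{t\times t}$ such that $N_{ij}=0$ if $\mathcal{N}_{ij}=0$; $N_{ij}\neq 0$ if $\mathcal{N}_{ij}=\ast$ (entries with $\mathcal{N}_{ij}=?$ may be zero or nonzero); and $N_{ij}=N_{mn}$ whenever $(i,j),(m,n)$ belong to the same set $\mathcal{I}^\ast_r$ or to the same set $\mathcal{I}^?_s$. $(\mathcal{N},\pi)$ is called nonsingular if all matrices in $\mathcal{P}(\mathcal{N},\pi)$ are nonsingular. The colored bipartite graph $G(\mathcal{N},\pi)=(X,Y,E_{XY},\pi_{XY})$ has vertex sets $X=\{x_1,\ldots,x_t\}$, $Y=\{y_1,\ldots,y_t\}$, and $\{x_i,y_j\}\in E_{XY}$ if and only if $\mathcal{N}_{ji}\in\{\ast,?\}$. Put $E^\ast_{XY}=\{\{x_i,y_j\}\in E_{XY}\mid \mathcal{N}_{ji}=\ast\}$ (solid edges) and $E^?_{XY}=\{\{x_i,y_j\}\in E_{XY}\mid \mathcal{N}_{ji}=?\}$ (dashed edges). The partition $\pi_{XY}$ of $E_{XY}$ consists of the sets $E^{\ast r}_{XY}=\{\{x_i,y_j\}\in E^\ast_{XY}\mid (j,i)\in\mathcal{I}^\ast_r\}$, whose edges have color $c_r$ ($r=1,\ldots,k$), and $E^{?s}_{XY}=\{\{x_i,y_j\}\in E^?_{XY}\mid (j,i)\in\mathcal{I}^?_s\}$,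 whose edges have color $g_s$ ($s=1,\ldots,l$). A perfect matching is a set of $t$ edges no two of which share a vertex; it has the form $p=\{\{x_1,y_{\gamma(1)}\},\ldots,\{x_t,y_{\gamma(t)}\}\}$ for a permutation $\gamma$ of $(1,\ldots,t)$. Its sign is $\operatorname{sign}(p)=(-1)^m$, where $m$ is the number of swaps required to permute $(1,\ldots,t)$ to $(\gamma(1),\ldots,\gamma(t))$, i.e. the sign of $\gamma$. Its spectrum is the multiset of colors of its edges (the same color can appear multiple times). Two perfect matchings are equivalent if they have the same spectrum; this partitions the set of all perfect matchings into equivalence classes $\mathbb{P}_1,\ldots,\mathbb{P}_r$. The spectrum of $\mathbb{P}_i$ is the common spectrum of its members, and its signature is $\operatorname{sgn}(\mathbb{P}_i)=\sum_{p\in\mathbb{P}_i}\operatorname{sign}(p)$. *)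

(* Defs.v *)
From HB Require Import structures.
From mathcomp Require Import all_boot all_order all_fingroup all_algebra.
From mathcomp Require Import finmap multiset complex reals.

Set Implicit Arguments.
Unset Strict Implicit.
Unset Printing Implicit Defensive.

Import GRing.Theory.
Local Open Scope mset_scope.
Local Open Scope ring_scope.

Variant pattern_symbol : Set := PZero | PStar | PUnknown.

Definition pattern_symbol_eqb (a b : pattern_symbol) : bool :=
  match a, b with
  | PZero, PZero | PStar, PStar | PUnknown, PUnknown => true
  | _, _ => false
  end.

Lemma pattern_symbol_eqP : Equality.axiom pattern_symbol_eqb.
Proof. by case; case; constructor. Qed.

HB.instance Definition _ := hasDecEq.Build pattern_symbol pattern_symbol_eqP.

Definition pattern_locations t (N : 'M[pattern_symbol]_t) (s : pattern_symbol) :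
    {set 'I_t * 'I_t} :=
  [set ij | N ij.1 ij.2 == s].

Record coloring t (N : 'M[pattern_symbol]_t) := Coloring {
  star_blocks : {set {set 'I_t * 'I_t}};
  unknown_blocks : {set {set 'I_t * 'I_t}};
  star_blocksP : partition star_blocks (pattern_locations N PStar);
  unknown_blocksP : partition unknown_blocks (pattern_locations N PUnknown)
}.

Definition blocks t (N : 'M[pattern_symbol]_t) (pi : coloring N) :
    {set {set 'I_t * 'I_t}} :=
  star_blocks pi :|: unknown_blocks pi.

Definition pattern_class (R : realType) t (N : 'M[pattern_symbol]_t)
    (pi : coloring N) (A : 'M[R[i]]_t) : Prop :=
  [/\ forall i j, N i j = PZero -> A i j = 0,
      forall i j, N i j = PStar -> A i j != 0
    & forall B, B \in blocks pi ->
        {in B &, forall u v, A u.1 u.2 = A v.1 v.2}].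

Definition nonsingular_pattern (R : realType) t (N : 'M[pattern_symbol]_t)
    (pi : coloring N) : Prop :=
  forall A : 'M[R[i]]_t, pattern_class pi A -> A \in unitmx.

(* Both vertex sets are copies of 'I_t; the pair (i, j) stands for the
   undirected edge {x_i, y_j}. *)
Definition edge t : finType := ('I_t * 'I_t)%type.

Record colored_bigraph t := ColoredBigraph {
  edges : {set edge t};
  solid_edges : {set edge t};
  dashed_edges : {set edge t};
  edge_partition : {set {set edge t}}
}.

(* The edge {x_i, y_j} sits at the location (j, i), hence the swaps below. *)
Definition pattern_graph t (N : 'M[pattern_symbol]_t) (pi : coloring N) :
    colored_bigraph t :=
  {| edges := [set e : edge t | N e.2 e.1 \in [:: PStar; PUnknown]];
     solid_edges := [set e : edge t | N e.2 e.1 == PStar];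
     dashed_edges := [set e : edge t | N e.2 e.1 == PUnknown];
     edge_partition :=
       [set [set e : edge t | (e.2, e.1) \in B] | B : {set 'I_t * 'I_t}
          in blocks pi] |}.

Section Matchings.
Variables (t : nat) (G : colored_bigraph t).

Definition perfect_matching (p : {set edge t}) : bool :=
  [&& p \subset edges G, #|p| == t
    & [forall e in p, forall f in p,
         (e.1 == f.1) || (e.2 == f.2) ==> (e == f)]].

Definition perfect_matchings : {set {set edge t}} :=
  [set p | perfect_matching p].

Definition perm_edges (g : 'S_t) : {set edge t} :=
  [set (i, g i) | i : 'I_t].

(* The default value 1 is never reached on a perfect matching, see
   perfect_matching_perm. *)
Definition matching_perm (p : {set edge t}) : 'S_t :=
  odflt 1%g [pick g | p == perm_edges g].

Definition matching_sign (p : {set edge t}) : int := (-1) ^+ matching_perm p.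

(* The class of the partition containing e serves as the color of e, so that
   distinct classes have distinct colors. *)
Definition color (e : edge t) : {set edge t} := pblock (edge_partition G) e.

Definition spectrum (p : {set edge t}) : {mset {set edge t}} :=
  seq_mset [seq color e | e <- enum p].

Definition matching_classes : {set {set {set edge t}}} :=
  equivalence_partition (fun p q => spectrum p == spectrum q) perfect_matchings.

(* The chosen representative is irrelevant, see class_spectrumE. *)
Definition class_spectrum (P : {set {set edge t}}) : {mset {set edge t}} :=
  spectrum (odflt set0 [pick p in P]).

Definition signature (P : {set {set edge t}}) : int :=
  \sum_(p in P) matching_sign p.

Definition solid_color (c : {set edge t}) : Prop :=
  exists2 e, e \in solid_edges G & c = color e.

Lemma perm_edges_inj : injective perm_edges.
Proof.
move=> g h gh; apply/permP => i.
have: (i, g i) \in perm_edges h by rewrite -gh; apply/imsetP; exists i.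
by case/imsetP => j _ [-> ->].
Qed.

Lemma perm_edgesK : cancel perm_edges matching_perm.
Proof.
move=> g; rewrite /matching_perm; case: pickP => [h /eqP|/(_ g)] /=.
  by move/perm_edges_inj.
by rewrite eqxx.
Qed.

Lemma perfect_matching_perm p :
  perfect_matching p -> p = perm_edges (matching_perm p).
Proof.
case/and3P => _ /eqP card_p /forall_inP p_disj.
have injp (k : edge t -> 'I_t) : k = fst \/ k = snd -> {in p &, injective k}.
  move=> kE e f ep fp kef; apply/eqP.
  have /forall_inP/(_ _ fp)/implyP := p_disj _ ep; apply.
  by case: kE kef => -> ->; rewrite eqxx ?orbT.
have fst_p : fst @: p = setT.
  have fst_inj := injp fst (or_introl erefl).
  apply/eqP; rewrite eqEcard subsetT cardsT card_ord.
  by rewrite (card_in_imset fst_inj) card_p /=.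
have /fin_all_exists [g gP] : forall i : 'I_t, exists j, (i, j) \in p.
  move=> i; have: i \in fst @: p by rewrite fst_p inE.
  by case/imsetP => -[a b] ? /= ->; exists b.
have g_inj : injective g.
  move=> i j gij.
  by have [] := injp snd (or_intror erefl) _ _ (gP i) (gP j) gij.
suff -> : p = perm_edges (perm g_inj) by rewrite perm_edgesK.
apply/esym/eqP; rewrite eqEcard; apply/andP; split.
  by apply/subsetP => _ /imsetP[i _ ->]; rewrite permE.
rewrite card_p card_imset; last by move=> i j [].
by rewrite card_ord.
Qed.

Lemma class_spectrumE P p :
  P \in matching_classes -> p \in P -> class_spectrum P = spectrum p.
Proof.
case/imsetP => r _ -> pP; rewrite /class_spectrum.
case: pickP => [q|/(_ p)]; last by rewrite pP.
by move: pP; rewrite !inE => /andP[_ /eqP <-] /andP[_ /eqP <-].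
Qed.

End Matchings.

Lemma edge_partitionP t (N : 'M[pattern_symbol]_t) (pi : coloring N) :
  partition (edge_partition (pattern_graph pi)) (edges (pattern_graph pi)).
Proof.
have [/and3P[/eqP covS triS nS0] /and3P[/eqP covU triU nU0]] :=
  (star_blocksP pi, unknown_blocksP pi).
have inS B u : B \in star_blocks pi -> u \in B -> N u.1 u.2 = PStar.
  move=> BS uB; have: u \in cover (star_blocks pi) by apply/bigcupP; exists B.
  by rewrite covS inE => /eqP.
have inU B u : B \in unknown_blocks pi -> u \in B -> N u.1 u.2 = PUnknown.
  move=> BU uB; have: u \in cover (unknown_blocks pi) by apply/bigcupP; exists B.
  by rewrite covU inE => /eqP.
have uniqB B C u : B \in blocks pi -> C \in blocks pi ->
    u \in B -> u \in C -> B = C.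
  case/setUP => HB /setUP[] HC uB uC.
  - by rewrite -(def_pblock triS HB uB) (def_pblock triS HC uC).
  - by move: (inS _ _ HB uB); rewrite (inU _ _ HC uC).
  - by move: (inS _ _ HC uC); rewrite (inU _ _ HB uB).
  - by rewrite -(def_pblock triU HB uB) (def_pblock triU HC uC).
apply/and3P; split.
- apply/eqP/setP => -[i j]; rewrite !inE /=; apply/bigcupP/orP.
    case=> _ /imsetP[B HB ->]; rewrite inE /= => uB.
    by case/setUP: HB => HB; [left|right];
      rewrite ?(inS _ _ HB uB) ?(inU _ _ HB uB).
  case=> Nji.
    have: (j, i) \in cover (star_blocks pi) by rewrite covS inE.
    case/bigcupP => B HB uB; exists [set e : edge t | (e.2, e.1) \in B].
      by apply: imset_f; rewrite inE HB.
    by rewrite inE.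
  have: (j, i) \in cover (unknown_blocks pi).
    by rewrite covU inE.
  case/bigcupP => B HB uB; exists [set e : edge t | (e.2, e.1) \in B].
    by apply: imset_f; rewrite inE HB orbT.
  by rewrite inE.
- apply/trivIsetP => _ _ /imsetP[B HB ->] /imsetP[C HC ->].
  apply: contraR => /pred0Pn[e /andP[/=]]; rewrite !inE => eB eC.
  by rewrite (uniqB _ _ _ HB HC eB eC).
apply/imsetP => -[B HB /setP B0].
suff B00 : B = set0 by move: HB; rewrite B00 inE (negPf nS0) (negPf nU0).
by apply/setP => -[i j]; have := B0 (j, i); rewrite !inE.
Qed.

(* Main.v *)
(* Assign to every color c a value v c.  Grouping the Leibniz expansion of the
   determinant by equivalence classes of perfect matchings turns it into
     \sum_P sgn(P) * \prod_(c in the spectrum of P) v c,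
   a polynomial in the v c whose monomials are pairwise distinct.  If it never
   vanishes, evaluate it at v c = z ^ (b ^ r c), where r numbers the colors and
   b = t + 1 exceeds all multiplicities: distinct spectra then give distinct
   powers of z, and a univariate complex polynomial without nonzero root is a
   monomial, so that only one class has a nonzero signature.  The value 1 on
   solid colors and 0 on dashed ones shows that its spectrum is solid. *)
Require Import Defs.
From mathcomp Require Import all_boot all_order all_fingroup all_algebra.
From mathcomp Require Import finmap multiset complex reals.

Set Implicit Arguments.
Unset Strict Implicit.
Unset Printing Implicit Defensive.

Import GRing.Theory Num.Theory.
Local Open Scope mset_scope.
Local Open Scope ring_scope.

(** * Uniqueness of base-b digits, and polynomials without nonzero roots *)

Lemma digits_inj b n (d d' : nat -> nat) :
  (forall i, d i < b)%N -> (forall i, d' i < b)%N ->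
  (\sum_(i < n) d i * b ^ i = \sum_(i < n) d' i * b ^ i)%N ->
  forall i, (i < n)%N -> d i = d' i.
Proof.
elim: n d d' => [//|n IHn] d d' db d'b.
have b_gt0 : (0 < b)%N by apply: leq_ltn_trans (db 0%N).
have split_low (f : nat -> nat) :
    (\sum_(i < n.+1) f i * b ^ i =
       f 0 + (\sum_(i < n) f i.+1 * b ^ i) * b)%N.
  rewrite big_ord_recl expn0 muln1 big_distrl; congr (_ + _)%N.
  by apply: eq_bigr => i _; rewrite lift0 expnSr mulnA.
rewrite !split_low => eq_dd'.
(* Reduction modulo [b] isolates the lowest digit; cancelling it and dividing by [b] shifts the
   remaining digits down for the induction. *)
have eq0 : d 0%N = d' 0%N.
  have := congr1 (modn^~ b) eq_dd'.
  by rewrite ![(_ + _ * b)%N]addnC !modnMDl !modn_small.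
move: eq_dd'; rewrite eq0 => /addnI/eqP; rewrite eqn_pmul2r // => /eqP eq_hi.
case=> [//|i] lt_in; apply: (IHn (d \o succn) (d' \o succn)) => // j.
  exact: db.
exact: d'b.
Qed.

(** Over an algebraically closed field [p] splits into linear factors. All its roots are 0, so every
    factor is ['X] and [p] is a monomial. *)
Lemma coef_no_nonzero_root (F : closedFieldType) (p : {poly F}) i j :
  (forall x, x != 0 -> p.[x] != 0) -> p`_i != 0 -> p`_j != 0 -> i = j.
Proof.
move=> p_neq0; have [s def_p] := closed_field_poly_normal p.
have {def_p} -> : p = lead_coef p *: 'X^(size s).
  rewrite {1}def_p; congr (_ *: _); rewrite big_seq.
  rewrite (eq_bigr (fun=> 'X)) => [|z zs].
    by rewrite -big_seq big_const_seq count_predT -Monoid.iteropE.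
  have [->|/p_neq0] := eqVneq z 0; first by rewrite subr0.
  by rewrite def_p hornerZ (rootP _) ?mulr0 ?eqxx // root_prod_XsubC.
rewrite !coefZ !coefXn.
have [->|_] := eqVneq i (size s); last by rewrite mulr0 eqxx.
by have [->|_] := eqVneq j (size s); last by rewrite mulr0 eqxx.
Qed.

(** * Determinant expansion over classes of perfect matchings *)

Section MatchingExpansion.

Variables (t : nat) (N : 'M[pattern_symbol]_t) (pi : coloring N).

Local Notation G := (pattern_graph pi).

Lemma mem_edges (e : edge t) : (e \in edges G) = (N e.2 e.1 != PZero).
Proof. by rewrite !inE; case: (N _ _). Qed.

Lemma perfect_matching_perm_edges (g : 'S_t) :
  perfect_matching G (perm_edges g) = [forall i, (i, g i) \in edges G].
Proof.
apply/and3P/forallP => [[/subsetP sub_gG _ _] i | gG].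
  by apply: sub_gG; apply: imset_f.
split; first by apply/subsetP => _ /imsetP[i _ ->].
  by rewrite card_imset ?card_ord // => i j [].
apply/forall_inP => _ /imsetP[i _ ->]; apply/forall_inP => _ /imsetP[j _ ->] /=.
by apply/implyP; rewrite (inj_eq perm_inj) orbb => /eqP ->.
Qed.

Lemma size_spectrum p : size (spectrum G p) = #|p|.
Proof. by rewrite (perm_size (perm_eq_seq_mset _)) size_map -cardE. Qed.

Lemma prod_spectrum (S : comNzRingType) (v : {set edge t} -> S) p :
  \prod_(c <- spectrum G p) v c = \prod_(e in p) v (color G e).
Proof.
by rewrite (perm_big _ (perm_eq_seq_mset _)) big_map big_enum.
Qed.

Lemma matching_classesP : partition (matching_classes G) (perfect_matchings G).
Proof.
apply: equivalence_partitionP => p q r _ _ _; split=> //.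
by move/eqP->.
Qed.

Lemma class_has_matching P :
  P \in matching_classes G -> exists2 p, p \in P & perfect_matching G p.
Proof.
have /and3P[/eqP covP _ nP0] := matching_classesP => PG.
have /set0Pn[p pP]: P != set0 by apply: contraNneq nP0 => <-.
exists p => //; suff: p \in perfect_matchings G by rewrite inE.
by rewrite -covP; apply/bigcupP; exists P.
Qed.

(** The classes are the fibres of [spectrum]; this makes the monomials of the expansion pairwise
    distinct. *)
Lemma class_spectrum_inj :
  {in matching_classes G &, injective (class_spectrum G)}.
Proof.
move=> P Q PG QG; have [p pP pG] := class_has_matching PG.
have [q qQ qG] := class_has_matching QG.
rewrite (class_spectrumE PG pP) (class_spectrumE QG qQ) => eq_pq.
case/imsetP: PG pP => p0 _ ->; rewrite !inE => /andP[_ /eqP p0p].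
case/imsetP: QG qQ => q0 _ ->; rewrite !inE => /andP[_ /eqP q0q].
by apply/setP => r; rewrite !inE p0p q0q eq_pq.
Qed.

Lemma size_class_spectrum P :
  P \in matching_classes G -> size (class_spectrum G P) = t.
Proof.
move=> PG; have [p pP /and3P[_ /eqP card_p _]] := class_has_matching PG.
by rewrite (class_spectrumE PG pP) size_spectrum.
Qed.

Lemma det_matching_classes (S : comNzRingType) (A : 'M[S]_t)
    (v : {set edge t} -> S) :
    (forall i j, N i j = PZero -> A i j = 0) ->
    (forall i j, N i j != PZero -> A i j = v (color G (j, i))) ->
  \det A = \sum_(P in matching_classes G)
             (signature P)%:~R * \prod_(c <- class_spectrum G P) v c.
Proof.
(* After transposition, the factor of [g] at [i] is the entry at location [(g i, i)], which is that
   of the edge [(i, g i)]. *)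
move=> A0 Av; rewrite -det_tr.
transitivity (\sum_(p in perfect_matchings G)
    (matching_sign p)%:~R * \prod_(c <- spectrum G p) v c).
  rewrite (reindex_onto (@perm_edges t) (@matching_perm t)) /=; last first.
    by move=> p; rewrite inE => /perfect_matching_perm.
  (* A permutation that does not give a perfect matching meets a zero entry, so its Leibniz term
     vanishes. *)
  rewrite [RHS]big_mkcond; apply: eq_bigr => g _.
  rewrite perm_edgesK eqxx andbT inE perfect_matching_perm_edges.
  case: ifP => [/forallP gG|/negbT].
    rewrite prod_spectrum big_imset /=; last by move=> i j _ _ [].
    rewrite /matching_sign perm_edgesK rmorphXn rmorphN1; congr (_ * _).
    apply: eq_big => // i _.
    by rewrite mxE Av // -[N _ _]/(N (i, g i).2 (i, g i).1) -mem_edges.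
  rewrite negb_forall => /existsP[k]; rewrite mem_edges negbK /= => /eqP Ngk.
  by rewrite (bigD1 k) //= mxE A0 // mul0r mulr0.
rewrite (set_partition_big _ matching_classesP) /=.
apply: eq_bigr => P PG; rewrite /signature rmorph_sum big_distrl /=.
by apply: eq_bigr => p pP; rewrite (class_spectrumE PG pP).
Qed.

(** No condition is put on [v], so dashed colors may take the value 0; membership in the pattern
    class only constrains the solid ones. *)
Definition color_matrix (S : comNzRingType) (v : {set edge t} -> S) : 'M[S]_t :=
  \matrix_(i, j) if N i j == PZero then 0 else v (color G (j, i)).

Lemma det_color_matrix (S : comNzRingType) (v : {set edge t} -> S) :
  \det (color_matrix v) = \sum_(P in matching_classes G)
             (signature P)%:~R * \prod_(c <- class_spectrum G P) v c.
Proof.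
apply: det_matching_classes => i j Nij; rewrite mxE ?Nij //.
by rewrite (negPf Nij).
Qed.

Lemma color_block B u :
  B \in blocks pi -> u \in B ->
  color G (u.2, u.1) = [set e : edge t | (e.2, e.1) \in B].
Proof.
have /and3P[_ trivG _] := edge_partitionP pi.
move=> BG uB; apply: def_pblock trivG _ _; first exact: imset_f.
by rewrite inE -surjective_pairing.
Qed.

Lemma block_neq0 B u : B \in blocks pi -> u \in B -> N u.1 u.2 != PZero.
Proof.
have /and3P[/eqP covG _ _] := edge_partitionP pi.
move=> BG uB; rewrite -(mem_edges (u.2, u.1)) -covG; apply/bigcupP.
exists [set e : edge t | (e.2, e.1) \in B]; first exact: imset_f.
by rewrite inE -surjective_pairing.
Qed.

Lemma color_matrix_class (R : realType) (v : {set edge t} -> R[i]) :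
  (forall e, e \in solid_edges G -> v (color G e) != 0) ->
  pattern_class pi (color_matrix v).
Proof.
move=> v_neq0; split=> [i j Nij|i j Nij|B BG u w uB wB]; rewrite !mxE.
- by rewrite Nij.
- by rewrite Nij; apply: v_neq0; rewrite inE Nij.
by rewrite !(negPf (block_neq0 BG _)) // !(color_block BG).
Qed.

Lemma pattern_class_color (R : realType) (A : 'M[R[i]]_t) :
  pattern_class pi A ->
  exists v, forall i j, N i j != PZero -> A i j = v (color G (j, i)).
Proof.
case=> _ _ A_const.
have /and3P[/eqP covG _ _] := edge_partitionP pi.
(* The value of a color is read off at any edge of it, as [A] is constant on blocks; the default 0
   is never reached on the color of an edge. *)
exists (fun c : {set edge t} =>
  if [pick e in c] is Some e then A e.2 e.1 else 0) => i j Nij.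
have : (j, i) \in cover (edge_partition G) by rewrite covG mem_edges.
case/bigcupP=> _ /imsetP[B BG ->]; rewrite inE /= => ijB.
rewrite (color_block BG ijB); case: pickP => [e|/(_ (j, i))]; rewrite inE.
  exact: A_const BG _ _ ijB.
by rewrite ijB.
Qed.

End MatchingExpansion.

(** * Encoding of spectra as exponents *)

Section Weight.

Variables (t : nat) (C : finType).

Definition weight (m : {mset C}) : nat := \sum_(c <- m) t.+1 ^ enum_rank c.

(** Collecting equal colors exhibits the multiplicities as the base [t.+1] digits of the weight. *)
Lemma weightE (m : {mset C}) :
  weight m = (\sum_(i < #|C|) count_mem (enum_val i) m * t.+1 ^ i)%N.
Proof.
rewrite /weight; elim: (m : seq C) => [|c s IHs] /=.
  by rewrite big_nil big1.
rewrite big_cons {}IHs; under [RHS]eq_bigr do rewrite mulnDl.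
rewrite big_split [X in (_ = X + _)%N](bigD1 (enum_rank c)) //=.
rewrite enum_rankK eqxx mul1n [X in (_ + X + _)%N]big1 ?addn0 // => i.
rewrite -(inj_eq enum_val_inj) enum_rankK.
by rewrite eq_sym => /negPf->.
Qed.

Lemma weight_inj (m m' : {mset C}) :
  size m = t -> size m' = t -> weight m = weight m' -> m = m'.
Proof.
(* [digits_inj] expects digits indexed by all naturals: positions past the last color get 0. Size
   [t] bounds every digit by [t]. *)
pose digit (k : {mset C}) i := oapp (fun j => count_mem (enum_val j) k) 0%N
  (insub i : option 'I_#|C|).
have digitE k (i : 'I_#|C|) : digit k i = count_mem (enum_val i) k.
  by rewrite /digit valK.
have digit_lt (k : {mset C}) i : size k = t -> (digit k i < t.+1)%N.
  by move=> <-; rewrite ltnS /digit; case: insub => //= j; apply: count_size.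
have weight_digit k : weight k = (\sum_(i < #|C|) digit k i * t.+1 ^ i)%N.
  by rewrite weightE; apply: eq_bigr => i _; rewrite digitE.
move=> sz_m sz_m'; rewrite !weight_digit => /digits_inj eq_digit.
rewrite -[m]seq_mset_id -[m']seq_mset_id; apply/eq_seq_msetP/allP => c _ /=.
rewrite -(enum_rankK c) -!digitE eq_digit // => i; exact: digit_lt.
Qed.

End Weight.

(** * Characterization of nonsingularity *)

Theorem theorem11 (R : realType) (t : nat) (N : 'M[pattern_symbol]_t)
    (pi : coloring N) :
  nonsingular_pattern R pi <->
  [/\ exists p, perfect_matching (pattern_graph pi) p,
      exists! P, P \in matching_classes (pattern_graph pi) /\ signature P <> 0
    & forall P, P \in matching_classes (pattern_graph pi) ->
        signature P <> 0 ->
        forall c, c \in class_spectrum (pattern_graph pi) P ->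
          solid_color (pattern_graph pi) c].
Proof.
set G := pattern_graph pi.
split=> [nonsing|[_ [P [[PG /eqP sgnP] uniqP]] solidP]]; last first.
  (* Sufficiency: only the term of [P] survives in the determinant, and each factor of its product
     is a nonzero entry at a solid location. *)
  move=> A clA; have [v Av] := pattern_class_color clA; case: clA => A0 Astar _.
  rewrite unitmxE (det_matching_classes A0 Av) (bigD1 P) //=.
  rewrite [X in _ + X]big1 => [|Q].
    rewrite addr0 unitfE mulf_neq0 ?intr_eq0 // prodf_seq_neq0.
    apply/allP => c /(solidP _ PG (elimN eqP sgnP))[[i j]].
    rewrite inE => /eqP Nji ->.
    by rewrite -Av ?Nji ?Astar.
  case/andP=> QG; apply: contraNeq; rewrite mulf_eq0 negb_or intr_eq0.
  by case/andP=> /eqP sgnQ _; rewrite -(uniqP Q).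
have det_neq0 (v : {set edge t} -> R[i]) :
    (forall e, e \in solid_edges G -> v (color G e) != 0) ->
    \sum_(P in matching_classes G)
      (signature P)%:~R * \prod_(c <- class_spectrum G P) v c != 0.
  move=> v_neq0; rewrite -det_color_matrix -unitfE -unitmxE.
  exact/nonsing/color_matrix_class.
pose wt P := weight t (class_spectrum G P).
(* [f.[x]] is the determinant of the color matrix giving each color [c] the value
   [x ^+ (t.+1 ^ enum_rank c)]. *)
pose f : {poly R[i]} :=
  \sum_(P in matching_classes G) (signature P)%:~R *: 'X^(wt P).
have f_neq0 x : x != 0 -> f.[x] != 0.
  move=> x_neq0; rewrite horner_sum.
  rewrite (eq_bigr (fun P => (signature P)%:~R *
      \prod_(c <- class_spectrum G P) x ^+ (t.+1 ^ enum_rank c))) => [|P _].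
    by apply: det_neq0 => e _; rewrite expf_neq0.
  by rewrite hornerZ hornerXn -expr_sum.
have coef_f P : P \in matching_classes G -> f`_(wt P) = (signature P)%:~R.
  move=> PG; rewrite coef_sum (bigD1 P) //= coefZ coefXn eqxx mulr1.
  rewrite big1 ?addr0 // => Q /andP[QG neqQP]; rewrite coefZ coefXn.
  case: eqP => [/weight_inj eqPQ|]; last by rewrite mulr0.
  case/eqP: neqQP; apply: (class_spectrum_inj QG PG); apply/esym.
  by apply: eqPQ; rewrite size_class_spectrum.
(* Two nonzero signatures are nonzero coefficients of the monomial [f]; equal exponents force equal
   spectra, hence equal classes. *)
have sgn_unique P Q : P \in matching_classes G -> Q \in matching_classes G ->
    signature P != 0 -> signature Q != 0 -> P = Q.
  move=> PG QG sgnP sgnQ; apply: (class_spectrum_inj PG QG).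
  apply: weight_inj; rewrite ?size_class_spectrum //.
  by apply: (coef_no_nonzero_root f_neq0); rewrite -/(wt _) coef_f ?intr_eq0.
pose v c : R[i] := if c \in [set color G e | e in solid_edges G] then 1 else 0.
have v_neq0 e : e \in solid_edges G -> v (color G e) != 0.
  by move=> eG; rewrite /v imset_f // oner_eq0.
(* The sum at the 0-1 valuation is nonzero, so some term is: its signature is nonzero and every
   color of its spectrum has value 1, hence is solid. *)
have /existsP[P /andP[PG]] : [exists P in matching_classes G,
    (signature P)%:~R * \prod_(c <- class_spectrum G P) v c != 0].
  apply: contraR (det_neq0 _ v_neq0) => /exists_inPn nz.
  by rewrite big1 // => P PG; apply/eqP; rewrite -[_ == _]negbK nz.
rewrite mulf_eq0 negb_or intr_eq0 prodf_seq_neq0 => /andP[sgnP /allP v_spec].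
split.
- by have [p _ pG] := class_has_matching PG; exists p.
- exists P; split=> [|Q [QG /eqP sgnQ]]; last exact: sgn_unique.
  by split; last exact/eqP.
move=> Q QG /eqP sgnQ c; rewrite (sgn_unique Q P) // => /v_spec.
by rewrite /v; case: ifP => [/imsetP[e eG ->] _|]; [exists e | rewrite eqxx].
Qed.
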